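(* For any algorithm $\mathbf{Alg}$ and any $d$, $C$, $\kappa>0$ and $T\ge\max\{4d^2/25,\,dC\}$, there exists an instance of the contextual dueling bandit with adversarial feedback (feature map, action set, parameter $\theta^*$, an adversary using at most $C$ adversarial feedbacks, and an increasing link function $\sigma$ with $\sigma(z)+\sigma(-z)=1$) whose link function satisfies $\dot\sigma(\langle\phi(x,a)-\phi(x,b),\theta\rangle)\ge\kappa$ for all $x\in\mathcal X$, $a,b\in\mathcal A$, $\theta\in\Theta$, such that the (expected) regret of $\mathbf{Alg}$ over $T$ rounds is $\Omega\big((d\sqrt T+dC)/\kappa\big)$.
   Context: Setting (contextual linear dueling bandit with adversarial feedback). There is a context set $\mathcal X$, an action set $\mathcal A$, and a feature map $\phi:\mathcal X\times\mathcal A\to\mathbb R^d$ known to the learner; the unknown parameter is $\theta^*\in\Theta\subseteq\mathbb R^d$ and the reward is $r^*(x,a)=\langle\theta^*,\phi(x,a)\rangle$. In each round $t=1,\dots,T$: a context $x_t$ is revealed, the agent picks actions $a_t,b_t\in\mathcal A$, a true preference label $l_t\in\{0,1\}$ is drawn with $\Pr(l_t=1\mid\text{past},x_t,a_t,b_t)=\sigma(\langle\phi(x_t,a_t)-\phi(x_t,b_t),\theta^*\rangle)$; an adversary who sees $x_t,a_t,b_t,l_t$ (and the past) chooses $c_t\in\{0,1\}$, and the agent observes $o_t=l_t$ if $c_t=0$ and $o_t=1-l_t$ if $c_t=1$, with $\sum_{t=1}^Tc_t\le C$. With $a_t^*=\arg\max_{a\in\mathcal A}r^*(x_t,a)$,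 $\mathrm{Regret}(T)=\sum_{t=1}^T\big(2r^*(x_t,a_t^* )-r^*(x_t,a_t)-r^*(x_t,b_t)\big)$. *)

(* Defs.v *)
From HB Require Import structures.
From mathcomp Require Import all_boot all_order all_algebra.
From mathcomp Require Import all_classical all_reals all_analysis.
Set Implicit Arguments. Unset Strict Implicit. Unset Printing Implicit Defensive.
Import Order.TTheory GRing.Theory Num.Theory.
Local Open Scope ring_scope.

Section Dueling.
Variable R : realType.

Definition dotv (d : nat) (u v : 'rV[R]_d) : R := \sum_(i < d) u 0 i * v 0 i.
Definition normv (d : nat) (v : 'rV[R]_d) : R := Num.sqrt (dotv v v).

(* Full record of a round (hidden to the learner): context, the two actions,
   true label l_t and corruption bit c_t. *)
Record round (X : Type) (A : Type) := Round
  { rx : X; ra : A; rb : A; rl : bool; rc : bool }.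

Record obs (X : Type) (A : Type) := Obs
  { ox : X; oa : A; ob : A; oo : bool }.

Definition observe X A (e : round X A) : obs X A :=
  Obs (rx e) (ra e) (rb e) (addb (rl e) (rc e)).

(* A (possibly randomized) learning algorithm.  It knows the public part of
   the instance (context set X, finite action set A, feature map phi, the
   radius B of the parameter set Theta = {theta : ||theta|| <= B}, the link
   function sigma, the corruption budget C and the horizon T), and maps the
   observed history and the current context to a probability distribution
   (weights) over pairs of actions (a_t, b_t). *)
Definition algorithm (d : nat) :=
  forall (X : Type) (A : finType), (X -> A -> 'rV[R]_d) -> R -> (R -> R) ->
    nat -> nat -> seq (obs X A) -> X -> A -> A -> R.

Definition valid_algorithm d (alg : algorithm d) : Prop :=
  forall (X : Type) (A : finType) phi B sigma C T hist x,
    (0 < #|A|)%N ->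
    (forall a b, 0 <= alg X A phi B sigma C T hist x a b) /\
    \sum_(a : A) \sum_(b : A) alg X A phi B sigma C T hist x a b = 1.

(* An adversary sees the full past, the context, the chosen actions and the
   true label, and decides whether to flip the label. *)
Definition adversary (X : Type) (A : Type) :=
  seq (round X A) -> X -> A -> A -> bool -> bool.

(* The adversary never corrupts once C corruptions have been made, so along
   every trajectory sum_t c_t <= C. *)
Definition budget_ok X A (adv : adversary X A) (C : nat) : Prop :=
  forall h x a b l, adv h x a b l -> (count (@rc X A) h < C)%N.

Section Regret.
Variables (d : nat) (X : Type) (A : finType).
Variables (phi : X -> A -> 'rV[R]_d) (theta : 'rV[R]_d) (sigma : R -> R).
Variables (ctx : nat -> X) (adv : adversary X A).
Variable (pol : seq (obs X A) -> X -> A -> A -> R).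

Definition reward x a : R := dotv theta (phi x a).

(* r*(x, a*_x) - r*(x,a) = max_{a'} (r*(x,a') - r*(x,a)) (the term a' = a is 0) *)
Definition gap x a : R := \big[Order.max/0]_(a' : A) (reward x a' - reward x a).

(* Expected regret accumulated in the next k rounds, given the full past h;
   the current round index is t = size h and the context is ctx t.
   Pr(l_t = 1 | ...) = sigma(<phi(x,a) - phi(x,b), theta*>). *)
Fixpoint exp_regret (k : nat) (h : seq (round X A)) : R :=
  match k with
  | 0 => 0
  | k'.+1 =>
    let x := ctx (size h) in
    \sum_(a : A) \sum_(b : A)
      pol (map (@observe X A) h) x a b *
      (gap x a + gap x b +
       (sigma (dotv (phi x a - phi x b) theta) *
          exp_regret k' (rcons h (Round x a b true (adv h x a b true))) +
        (1 - sigma (dotv (phi x a - phi x b) theta)) *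
          exp_regret k' (rcons h (Round x a b false (adv h x a b false)))))
  end.

End Regret.

End Dueling.

(* Main.v *)
Require Import Defs.
From HB Require Import structures.
From mathcomp Require Import all_boot all_order all_algebra.
From mathcomp Require Import all_classical all_reals all_analysis.
From mathcomp Require Import ring lra zify.
Import Order.TTheory GRing.Theory Num.Theory.
Local Open Scope ring_scope.

(** Two families of instances share the link function that is affine with slope
    kappa near 0 and saturates like [1/u] further out, and the parameter radius
    1/(16 kappa).

    If [d C] is at most of order [d sqrt T], nothing is corrupted, the actions
    are the vertices of the hypercube [{-1,1}^d / sqrt d], and [theta] is
    [delta sqrt d] times a sign vector with [delta] of order 1/(kappa sqrt T).
    Flipping one sign of [theta] changes every label probability by
    O(1/sqrt T), so over T rounds no algorithm tells the two parameters apart,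
    and averaging over all sign vectors it errs on a constant fraction of the
    [d T] signs it plays.

    Otherwise the actions are the signed basis vectors and [theta] is a multiple
    of one of them.  Only duels that touch the hidden coordinate are
    informative, and an adversary who flips their labels with probability 1/2
    turns them into fair coins.  During the first d(C/8) rounds a uniformly
    random coordinate is touched at most C/4 times on average, so with
    probability at least 3/4 the budget suffices and the algorithm learns
    nothing.  The adversary of the model is deterministic; the greedy one does
    at least as well as the coin. *)

(** * Expectation over the random pair of actions *)

Section Mean.
Context {R : realType} {A : finType}.
Implicit Types w F G : A -> A -> R.

Definition weights w :=
  (forall a b, 0 <= w a b) /\ \sum_(a : A) \sum_(b : A) w a b = 1.

Definition mean w F : R := \sum_(a : A) \sum_(b : A) w a b * F a b.

Lemma eq_mean w F G : (forall a b, F a b = G a b) -> mean w F = mean w G.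
Proof. by move=> FG; do 2!apply: eq_bigr => ? _; rewrite FG. Qed.

Lemma ler_mean w F G :
  weights w -> (forall a b, F a b <= G a b) -> mean w F <= mean w G.
Proof. by case=> w0 _ FG; do 2!apply: ler_sum => ? _; rewrite ler_wpM2l. Qed.

Lemma mean_cst w c : weights w -> mean w (fun _ _ => c) = c.
Proof.
case=> _ w1; rewrite -[RHS]mul1r -w1 mulr_suml.
by apply: eq_bigr => a _; rewrite mulr_suml.
Qed.

Lemma meanD w F G : mean w (fun a b => F a b + G a b) = mean w F + mean w G.
Proof.
rewrite -big_split; apply: eq_bigr => a _; rewrite -big_split.
by apply: eq_bigr => b _; rewrite mulrDr.
Qed.

Lemma meanZ w c F : mean w (fun a b => c * F a b) = c * mean w F.
Proof.
rewrite mulr_sumr; apply: eq_bigr => a _; rewrite mulr_sumr.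
by apply: eq_bigr => b _; rewrite mulrCA.
Qed.

Lemma ge0_mean w F : weights w -> (forall a b, 0 <= F a b) -> 0 <= mean w F.
Proof. by move=> ww F0; rewrite -(mean_cst w 0 ww); apply: ler_mean. Qed.

End Mean.

(** * Expected payoffs along observed histories, and comparison of two instances *)

Section Value.
Context {R : realType} {X : Type} {A : finType}.
Variables (ctx : nat -> X) (pol : seq (obs X A) -> X -> A -> A -> R).
Hypothesis polP : forall ho x, weights (pol ho x).
Implicit Types (pay prob : X -> A -> A -> R) (ho : seq (obs X A)).

(* Expected total payoff over k rounds when the *observed* label is 1 with
   probability [prob]. *)
Fixpoint payoff pay prob (k : nat) ho : R :=
  if k is k'.+1 then
    let x := ctx (size ho) in
    mean (pol ho x) (fun a b => pay x a b +
      (prob x a b * payoff pay prob k' (rcons ho (Obs x a b true)) +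
       (1 - prob x a b) * payoff pay prob k' (rcons ho (Obs x a b false))))
  else 0.

Lemma ler_payoff pay pay' prob k ho :
  (forall x a b, 0 <= prob x a b <= 1) ->
  (forall x a b, pay x a b <= pay' x a b) ->
  payoff pay prob k ho <= payoff pay' prob k ho.
Proof.
move=> prob01 le_pay; elim: k ho => //= k IH ho.
apply: ler_mean => // a b; have /andP[p0 p1] := prob01 (ctx (size ho)) a b.
by rewrite lerD // lerD // ler_wpM2l // subr_ge0.
Qed.

Lemma payoff_cst c prob k ho : payoff (fun _ _ _ => c) prob k ho = k%:R * c.
Proof.
elim: k ho => [|k IH] ho /=; first by rewrite mul0r.
rewrite (eq_mean _ _ (fun _ _ => k.+1%:R * c)) ?mean_cst // => a b.
by rewrite !IH -[k.+1]addn1 natrD; ring.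
Qed.

Lemma payoff0 prob k ho : payoff (fun _ _ _ => 0) prob k ho = 0.
Proof. by rewrite payoff_cst mulr0. Qed.

Lemma payoffD pay pay' prob k ho :
  payoff (fun x a b => pay x a b + pay' x a b) prob k ho =
  payoff pay prob k ho + payoff pay' prob k ho.
Proof.
elim: k ho => [|k IH] ho /=; first by rewrite addr0.
by rewrite -meanD; apply: eq_mean => a b; rewrite !IH; ring.
Qed.

Lemma payoffZ c pay prob k ho :
  payoff (fun x a b => c * pay x a b) prob k ho = c * payoff pay prob k ho.
Proof.
elim: k ho => [|k IH] ho /=; first by rewrite mulr0.
by rewrite -meanZ; apply: eq_mean => a b; rewrite !IH; ring.
Qed.

Lemma eq_payoff pay pay' prob k ho :
  (forall x a b, pay x a b = pay' x a b) ->
  payoff pay prob k ho = payoff pay' prob k ho.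
Proof.
by move=> e; elim: k ho => //= k IH ho; apply: eq_mean => a b; rewrite e !IH.
Qed.

Lemma payoff_sum (I : finType) (pay : I -> X -> A -> A -> R) prob k ho :
  payoff (fun x a b => \sum_i pay i x a b) prob k ho =
  \sum_i payoff (pay i) prob k ho.
Proof.
elim: (index_enum I) => [|i s IH].
  rewrite big_nil -[RHS](payoff0 prob k ho).
  by apply: eq_payoff => x a b; rewrite big_nil.
by rewrite big_cons -IH -payoffD; apply: eq_payoff => x a b; rewrite big_cons.
Qed.

(* [y] is the likelihood ratio of the past under the two instances.  The weight
   [y - y^2/4 <= min 1 y] is quadratic in [y], so a round changes its mean only
   through the chi-square divergence of the label. *)
Lemma two_instances pay pay' prob prob' m chi k ho y :
  0 <= chi ->
  (forall x a b, 0 < prob x a b < 1) ->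
  (forall x a b, (prob' x a b - prob x a b) ^+ 2 <=
                 chi * (prob x a b * (1 - prob x a b))) ->
  (forall x a b, 0 <= pay x a b) -> (forall x a b, 0 <= pay' x a b) ->
  (forall x a b, pay x a b + pay' x a b = m) ->
  m * k%:R * (y - (1 + chi) ^+ k * y ^+ 2 / 4) <=
  payoff pay prob k ho + y * payoff pay' prob' k ho.
Proof.
move=> chi0 prob01 probP pay0 pay'0 payD.
have growth n : 1 <= (1 + chi) ^+ n by rewrite exprn_ege1 // lerDl.
elim: k ho y => [|k IH] ho y; first by rewrite /= !(mulr0, mul0r) addr0.
rewrite /= -meanZ -meanD; set x := ctx _.
rewrite -[leLHS](mean_cst (pol ho x)) //; apply: ler_mean => // a b.
have /andP[p0 p1] := prob01 x a b; have := probP x a b.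
have := pay0 x a b; have := pay'0 x a b; have := payD x a b.
set p := prob x a b in p0 p1 *; set q := prob' x a b.
set u := pay x a b; set u' := pay' x a b => mE u'0 u0 pq.
have r0 : 0 < 1 - p by rewrite subr_gt0.
have pN0 : p != 0 by rewrite gt_eqF.
have rN0 : 1 - p != 0 by rewrite gt_eqF.
have m0 : 0 <= m by rewrite -mE addr_ge0.
(* Bayes update of the likelihood ratio after each of the two labels. *)
have := IH (rcons ho (Obs x a b true)) (y * (q / p)).
have := IH (rcons ho (Obs x a b false)) (y * ((1 - q) / (1 - p))).
set V0 := payoff pay _ _ _; set U0 := payoff pay' _ _ _.
set V1 := payoff pay _ _ _; set U1 := payoff pay' _ _ _ => H0 H1.
have {H0} H0 := ler_wpM2l (ltW r0) H0; have {H1} H1 := ler_wpM2l (ltW p0) H1.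
have E1 : p * (V1 + y * (q / p) * U1) = p * V1 + y * (q * U1) by field.
have E0 : (1 - p) * (V0 + y * ((1 - q) / (1 - p)) * U0) =
          (1 - p) * V0 + y * ((1 - q) * U0) by field.
rewrite E0 in H0; rewrite E1 in H1.
have H01 := lerD H1 H0.
(* The excess of [u + y u'] over [m (y - y^2/4)] is a nonnegative combination of squares; a growth
   factor of at least 1 only lowers the left side. *)
have now : m * (y - (1 + chi) ^+ k.+1 * y ^+ 2 / 4) <= u + y * u'.
  apply: (@le_trans _ _ (m * (y - y ^+ 2 / 4))).
    by rewrite ler_wpM2l // lerD2l lerN2 ler_wpM2r // ler_peMl ?sqr_ge0 //.
  rewrite -mE -subr_ge0.
  have -> : u + y * u' - (u + u') * (y - y ^+ 2 / 4) =
            u * (1 - y / 2) ^+ 2 + u' * (y / 2) ^+ 2 by field.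
  by rewrite addr_ge0 // mulr_ge0 // sqr_ge0.
(* Under [p] the updated ratio has mean [y] and second moment [y^2 (1 + (q-p)^2 / (p (1-p)))], at
   most [(1 + chi) y^2]. *)
have later : m * k%:R * (y - (1 + chi) ^+ k.+1 * y ^+ 2 / 4) <=
    p * (m * k%:R * (y * (q / p) - (1 + chi) ^+ k * (y * (q / p)) ^+ 2 / 4)) +
    (1 - p) * (m * k%:R * (y * ((1 - q) / (1 - p)) -
        (1 + chi) ^+ k * (y * ((1 - q) / (1 - p))) ^+ 2 / 4)).
  rewrite exprS; set e := (1 + chi) ^+ k.
  have e0 : 0 <= e by apply: le_trans (growth k).
  rewrite -subr_ge0.
  set D := (X in 0 <= X).
  have -> : D = m * k%:R * e * y ^+ 2 / 4 *
      ((chi * (p * (1 - p)) - (q - p) ^+ 2) / (p * (1 - p))).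
    by rewrite /D; field; rewrite pN0 rN0.
  apply: mulr_ge0; first by rewrite divr_ge0 // mulr_ge0 ?sqr_ge0 // mulr_ge0 // mulr_ge0.
  by apply: divr_ge0; [rewrite subr_ge0 | rewrite mulr_ge0 // ltW].
have -> : m * k.+1%:R * (y - (1 + chi) ^+ k.+1 * y ^+ 2 / 4) =
   m * (y - (1 + chi) ^+ k.+1 * y ^+ 2 / 4) +
   m * k%:R * (y - (1 + chi) ^+ k.+1 * y ^+ 2 / 4).
  by rewrite -[k.+1%:R]natr1; ring.
move: (lerD now (le_trans later H01)); lra.
Qed.

End Value.

(** * Regret in terms of payoffs *)

Section Regret.
Context {R : realType} {d : nat} {X : Type} {A : finType}.
Variables (phi : X -> A -> 'rV[R]_d) (theta : 'rV[R]_d) (sigma : R -> R).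
Variables (ctx : nat -> X) (pol : seq (obs X A) -> X -> A -> A -> R).
Hypothesis polP : forall ho x, weights (pol ho x).
Hypothesis sigma01 : forall z, 0 <= sigma z <= 1.
Implicit Types (h : seq (round X A)).

Let gap := gap phi theta.
Let label x a b := sigma (dotv (phi x a - phi x b) theta).

Lemma reward_le_gap x a a' : reward phi theta x a' - reward phi theta x a <= gap x a.
Proof. exact: le_bigmax. Qed.

Lemma gap_ge0 x a : 0 <= gap x a.
Proof. by have := reward_le_gap x a a; rewrite subrr. Qed.

Lemma exp_regret_uncorrupted k h :
  exp_regret phi theta sigma ctx (fun _ _ _ _ _ => false) pol k h =
  payoff ctx pol (fun x a b => gap x a + gap x b) label k (map (@observe X A) h).
Proof.
elim: k h => //= k IH h; rewrite size_map; apply: eq_mean => a b.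
by rewrite !IH !map_rcons.
Qed.

(** * Dynamic programming for the adversary *)

Section Greedy.
Variable C : nat.

Definition corruptions h := count (@rc X A) h.

(** Bellman recursion: the maximum sits inside the expectation over the label because the flip is
    chosen after the true label is seen. *)
Fixpoint worst (k : nat) h : R :=
  if k is k'.+1 then
    let x := ctx (size h) in
    let next a b l :=
      if (corruptions h < C)%N then
        Num.max (worst k' (rcons h (Round x a b l false)))
                (worst k' (rcons h (Round x a b l true)))
      else worst k' (rcons h (Round x a b l false)) in
    mean (pol (map (@observe X A) h) x) (fun a b => gap x a + gap x b +
      (label x a b * next a b true + (1 - label x a b) * next a b false))
  else 0.

(** [T] serves to recover from the length of [h] how many rounds remain after the current one; ties
    leave the label intact. *)
Definition greedy (T : nat) : adversary X A := fun h x a b l =>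
  let k := (T - (size h).+1)%N in
  (corruptions h < C)%N && (worst k (rcons h (Round x a b l false)) <
                            worst k (rcons h (Round x a b l true))).

Lemma greedy_budget T : budget_ok (greedy T) C.
Proof. by move=> h x a b l /andP[]. Qed.

Lemma exp_regret_greedy T k h : (k + size h)%N = T ->
  exp_regret phi theta sigma ctx (greedy T) pol k h = worst k h.
Proof.
elim: k h => //= k IH h kT; apply: eq_mean => a b.
rewrite !IH ?size_rcons ?addnS -?kT //.
rewrite /greedy addSn subSS addnK.
by case: ifP => // _; rewrite /Num.max /=; do 2![case: ifP => _].
Qed.

Lemma worst_ge0 k h : 0 <= worst k h.
Proof.
elim: k h => //= k IH h; apply: ge0_mean => // a b.
have /andP[p0 p1] := sigma01 (dotv (phi (ctx (size h)) a - phi (ctx (size h)) b) theta).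
rewrite addr_ge0 ?addr_ge0 ?gap_ge0 // mulr_ge0 ?subr_ge0 //.
  by case: ifP => // _; rewrite le_max IH.
by case: ifP => // _; rewrite le_max IH.
Qed.

(* As long as budget is left, flipping the label with probability 1/2 makes an
   informative duel look like a fair coin; [lam] is the price of one corruption,
   high enough that an exhausted budget makes the bound trivial. *)
Lemma worst_ge_fair (g : X -> A -> A -> R) (informative : X -> A -> A -> bool)
    (G lam : R) (N : nat) :
  0 <= lam -> 0 <= G -> G * N%:R <= lam * C%:R ->
  (forall x a b, g x a b <= gap x a + gap x b) ->
  (forall x a b, g x a b <= G) ->
  (forall x a b, ~~ informative x a b -> label x a b = 1 / 2) ->
  forall k k' h, (k' <= k)%N -> (k' <= N)%N ->
  payoff ctx pol (fun x a b => g x a b - lam * (informative x a b)%:R)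
      (fun _ _ _ => 1 / 2) k' (map (@observe X A) h) - lam * (corruptions h)%:R
  <= worst k h.
Proof.
move=> lam0 G0 GN ggap gG info; elim=> [|k IH] [|k'] h //= k'k k'N.
- by rewrite sub0r oppr_le0 mulr_ge0.
(* Surplus rounds are dropped, regret being nonnegative. *)
- by rewrite sub0r (le_trans _ (worst_ge0 k.+1 h)) // oppr_le0 mulr_ge0.
rewrite size_map; set x := ctx _; set w := pol _ _.
set V := payoff _ _ _ _ k'.
have := worst_ge0 k.+1 h; rewrite /= -/x -/w.
have [ltC _|geC W0] := ltnP (corruptions h) C; last first.
  (* Budget exhausted: at most [N] rounds of payoff at most [G] are worth no more than [lam C], so
     the left side is nonpositive. *)
  apply: le_trans W0.
  rewrite subr_le0.
  apply: (@le_trans _ _ (lam * C%:R)); last by rewrite ler_wpM2l // ler_nat.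
  apply: le_trans GN.
  have : payoff ctx pol (fun x a b => g x a b - lam * (informative x a b)%:R)
      (fun _ _ _ => 1 / 2) k'.+1 (map (@observe X A) h) <= k'.+1%:R * G.
    rewrite -(payoff_cst ctx pol polP G (fun _ _ _ => 1 / 2) _ (map (@observe X A) h)).
    apply: ler_payoff => // [_ _ _|y a b]; first by lra.
    by rewrite (le_trans _ (gG y a b)) // lerBlDr lerDl mulr_ge0.
  rewrite /= size_map => /le_trans -> //.
  by rewrite mulrC ler_wpM2l // ler_nat.
rewrite lerBlDr -[lam * (corruptions h)%:R](mean_cst w); last exact: polP.
rewrite -meanD.
apply: ler_mean => [|a b]; first exact: polP.
have := ggap x a b.
have IHc l c := IH k' (rcons h (Round x a b l c)) k'k (ltnW k'N).
have ctc l c : corruptions (rcons h (Round x a b l c)) = (corruptions h + c)%N.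
  by rewrite /corruptions -cats1 count_cat /= addn0.
have := IHc true true; have := IHc true false.
have := IHc false true; have := IHc false false.
rewrite !map_rcons /observe /= !ctc !natrD -/V addr0.
set Vt := V (rcons _ (Obs _ _ _ true)); set Vf := V (rcons _ (Obs _ _ _ false)).
set W00 := worst k _; set W01 := worst k _.
set W10 := worst k _; set W11 := worst k _.
set n := (corruptions h)%:R.
have /andP[] := sigma01 (dotv (phi x a - phi x b) theta).
rewrite -/(label x a b); set p := label x a b.
have mx0 u v : u <= Num.max u v :> R by rewrite le_max lexx.
have mx1 u v : v <= Num.max u v :> R by rewrite le_max lexx orbT.
have := mx0 W00 W01; have := mx1 W00 W01.
have := mx0 W10 W11; have := mx1 W10 W11.
set M0 := Num.max W00 _; set M1 := Num.max W10 _.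
rewrite mulrDr mulr1.
have := info x a b; rewrite -/p.
case: (informative x a b) => /= [|/(_ isT) ->]; last by lra.
move=> _ h1 h2 h3 h4 p0 p1 h5 h6 h7 h8 h9.
(* The maximum dominates the average of keeping and flipping, under which the observed label is a
   fair coin; on average this costs [lam / 2], at most [lam]. *)
have e1 : (Vt + Vf) / 2 - lam * n - lam <= M1 by lra.
have e0 : (Vt + Vf) / 2 - lam * n - lam <= M0 by lra.
have := lerD (ler_wpM2l p0 e1) (ler_wpM2l (_ : 0 <= 1 - p) e0).
rewrite subr_ge0 => /(_ p1); lra.
Qed.

End Greedy.
End Regret.

(** * The link function *)

Section Link.
Import numFieldNormedType.Exports.
Local Open Scope classical_set_scope.
Context {R : realType}.
Implicit Types (u z kappa : R).

(** The outer pieces meet the identity at [1/4] and [-1/4] with equal value and slope, and tend to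
    [1/2] and [-1/2]. *)
Definition ramp u : R :=
  if u < - (1 / 4) then - (1 / 2) - u^-1 / 16
  else if u <= 1 / 4 then u else 1 / 2 - u^-1 / 16.

Lemma ramp_id u : `|u| <= 1 / 4 -> ramp u = u.
Proof. by rewrite ler_norml /ramp ltNge => /andP[-> ->]. Qed.

Lemma ramp_gt u : 1 / 4 < u -> ramp u = 1 / 2 - u^-1 / 16.
Proof.
move=> u4; rewrite /ramp (leNgt u) u4.
by case: ifPn => // u4'; move: u4 u4'; lra.
Qed.

Lemma rampN u : ramp (- u) = - ramp u.
Proof.
have [u4|u4] := leP `|u| (1 / 4); first by rewrite !ramp_id ?normrN.
have rpos (z : R) : 1 / 4 < z -> ramp (- z) = - ramp z.
  move=> z4; rewrite (ramp_gt _ z4) /ramp ltrN2 z4 invrN; ring.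
move: u4; rewrite lter_normr => /orP[/rpos //|/rpos].
by rewrite opprK => ->; rewrite opprK.
Qed.

Lemma ramp_pos_lt u z : 0 <= u -> u < z -> ramp u < ramp z.
Proof.
move=> u0 uz.
have iv (x : R) : 1 / 4 < x -> x^-1 < 4.
  by move=> x4; rewrite -[ltRHS]invrK ltf_pV2 ?posrE; lra.
have [z4|z4] := leP z (1 / 4).
  by rewrite !ramp_id // ler_norml; lra.
have [u4|u4] := leP u (1 / 4).
  rewrite ramp_id ?ramp_gt //; last by rewrite ler_norml; lra.
  have := iv z z4; lra.
have uzV : z^-1 < u^-1 by rewrite ltf_pV2 ?posrE; lra.
rewrite !ramp_gt //; lra.
Qed.

Lemma ramp_lt u z : u < z -> ramp u < ramp z.
Proof.
have r0 : ramp 0 = 0 by rewrite ramp_id ?normr0.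
have [u0 uz|u0 uz] := leP 0 u; first exact: ramp_pos_lt.
have [z0|z0] := leP z 0.
  by rewrite -ltrN2 -!rampN ramp_pos_lt ?oppr_ge0 ?ltrN2.
apply: (@lt_trans _ _ 0); last by rewrite -r0 ramp_pos_lt.
by rewrite -oppr_gt0 -rampN -r0 ramp_pos_lt ?oppr_gt0.
Qed.

Lemma ramp_le u : ramp u <= 1 / 2.
Proof.
have [u4|u4] := leP u (1 / 4).
  apply: (@le_trans _ _ (ramp (1 / 4))).
    move: u4; rewrite le_eqVlt => /orP[/eqP -> //|/ramp_lt]; exact: ltW.
  by rewrite ramp_id ?ger0_norm; lra.
by rewrite ramp_gt // gerBl divr_ge0 // invr_ge0; lra.
Qed.

Definition link kappa z : R := 1 / 2 + ramp (kappa * z).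

Lemma link_lt kappa z w : 0 < kappa -> z < w -> link kappa z < link kappa w.
Proof. by move=> k0 zw; rewrite ltrD2l ramp_lt // ltr_pM2l. Qed.

Lemma link01 kappa z : 0 <= link kappa z <= 1.
Proof.
have := ramp_le (kappa * z); have := ramp_le (- (kappa * z)).
by rewrite rampN /link; lra.
Qed.

Lemma linkN kappa z : link kappa z + link kappa (- z) = 1.
Proof. by rewrite /link mulrN rampN; lra. Qed.

Lemma link_affine kappa z :
  `|kappa * z| <= 1 / 4 -> link kappa z = 1 / 2 + kappa * z.
Proof. by move=> ?; rewrite /link ramp_id. Qed.

(** The strict inequality is an open condition, so the link is affine on a whole neighbourhood of
    [z]. *)
Lemma is_derive_link kappa z :
  `|kappa * z| < 1 / 4 -> is_derive z 1 (link kappa) kappa.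
Proof.
move=> kz.
have E : \forall y \near z, (fun y => 1 / 2 + kappa * y) y = link kappa y.
  have : \forall y \near z, `|kappa * y| < 1 / 4.
    have c : {for z, continuous (fun y : R => `|kappa * y|)}.
      by apply: (continuous_comp (g := fun y : R => `|y|));
        [exact: mulrl_continuous | exact: norm_continuous].
    exact: (c _ (lt_nbhsl kz)).
  by apply: filterS => y /ltW ?; rewrite link_affine.
apply: (near_eq_is_derive (f := fun y : R => 1 / 2 + kappa * y)); first exact: E.
by apply: is_derive_eq; rewrite add0r mul1r /GRing.scale /= mulr1.
Qed.

End Link.

(** * Euclidean inner product and norm *)

Section Dot.
Context {R : realType} {d : nat}.
Implicit Types u v w : 'rV[R]_d.

Lemma dotvC u v : dotv u v = dotv v u.
Proof. by apply: eq_bigr => i _; rewrite mulrC. Qed.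

Lemma dotvBl u v w : dotv (u - v) w = dotv u w - dotv v w.
Proof. by rewrite -sumrB; apply: eq_bigr => i _; rewrite !mxE mulrBl. Qed.

Lemma dotvv_ge0 u : 0 <= dotv u u.
Proof. by apply: sumr_ge0 => i _; rewrite -expr2 sqr_ge0. Qed.

Lemma normv_le u (r : R) : 0 <= r -> (normv u <= r) = (dotv u u <= r ^+ 2).
Proof. by move=> r0; rewrite -(ler_sqr (sqrtr_ge0 _) r0) sqr_sqrtr ?dotvv_ge0. Qed.

(** Cauchy-Schwarz, by expanding [sum_i (B u_i - v_i)^2 >= 0]. *)
Lemma dotv_le u v (B : R) : 0 < B -> normv u <= 1 -> normv v <= B -> dotv u v <= B.
Proof.
move=> B0; rewrite (normv_le u _ ler01) (normv_le v _ (ltW B0)) expr1n => uu vv.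
have : 0 <= \sum_i (B * u 0 i - v 0 i) ^+ 2 by apply: sumr_ge0 => i _; exact: sqr_ge0.
have -> : \sum_i (B * u 0 i - v 0 i) ^+ 2 =
          B ^+ 2 * dotv u u + dotv v v - 2 * B * dotv u v.
  rewrite /dotv !mulr_sumr -big_split -sumrB; apply: eq_bigr => i _ /=; ring.
rewrite -[_ <= B](ler_pM2l B0) => sq; have := ler_wpM2l (sqr_ge0 B) uu; lra.
Qed.

Lemma normvN u : normv (- u) = normv u.
Proof.
by congr Num.sqrt; apply: eq_bigr => i _; rewrite !mxE mulrNN.
Qed.

Lemma norm_dotv_diff u v w (B : R) : 0 < B ->
  normv u <= 1 -> normv v <= 1 -> normv w <= B -> `|dotv (u - v) w| <= 2 * B.
Proof.
move=> B0 u1 v1 wB; rewrite dotvBl.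
have bd x : normv x <= 1 -> `|dotv x w| <= B.
  move=> x1; rewrite ler_norml dotv_le // andbT lerNl.
  have -> : - dotv x w = dotv (- x) w.
    by rewrite -sumrN; apply: eq_bigr => i _; rewrite !mxE mulNr.
  by rewrite dotv_le // normvN.
by rewrite (le_trans (ler_normB _ _)) // mulr_natl mulr2n lerD // bd.
Qed.

End Dot.

(** * The parameter ball on which the link is affine *)

Section Radius.
Context {R : realType} {d : nat} {X : Type} {A : finType}.
Variables (phi : X -> A -> 'rV[R]_d) (kappa : R).
Hypotheses (kappa0 : 0 < kappa) (phi1 : forall x a, normv (phi x a) <= 1).

Definition param_radius : R := (16 * kappa)^-1.

Lemma param_radius_gt0 : 0 < param_radius.
Proof. by rewrite invr_gt0 mulr_gt0. Qed.

Lemma param_radiusK : kappa * param_radius = 1 / 16.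
Proof. by rewrite /param_radius; field; rewrite gt_eqF. Qed.

Lemma label_range x a b th : normv th <= param_radius ->
  `|kappa * dotv (phi x a - phi x b) th| <= 1 / 8.
Proof.
move=> thB; rewrite normrM gtr0_norm //.
have := norm_dotv_diff _ _ _ _ param_radius_gt0 (phi1 x a) (phi1 x b) thB.
rewrite -(ler_pM2l kappa0); have := param_radiusK; lra.
Qed.

Lemma link_label x a b th : normv th <= param_radius ->
  link kappa (dotv (phi x a - phi x b) th) =
  1 / 2 + kappa * dotv (phi x a - phi x b) th.
Proof.
by move=> thB; rewrite link_affine // (le_trans (label_range _ _ _ _ thB)) //; lra.
Qed.

Lemma link_slope x a b th : normv th <= param_radius ->
  derivable (link kappa) (dotv (phi x a - phi x b) th) 1 /\
  kappa <= derive1 (link kappa) (dotv (phi x a - phi x b) th).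
Proof.
move=> thB; have lt4 := le_lt_trans (label_range x a b th thB) (_ : 1 / 8 < 1 / 4).
have [] := is_derive_link _ _ (lt4 ltac:(lra)).
by rewrite derive1E => + ->.
Qed.

End Radius.

(** * Signs encoded by booleans *)

Section Sign.
Context {R : realType}.

Definition sg (b : bool) : R := if b then 1 else -1.

Lemma sgM b : sg b * sg b = 1.
Proof. by case: b; rewrite /sg ?mulrNN mulr1. Qed.

Lemma sgN b : sg (~~ b) = - sg b.
Proof. by case: b; rewrite /sg /= ?opprK. Qed.

Lemma one_sub_sgM b b' : 1 - sg b * sg b' = 2 * (b' != b)%:R.
Proof. by case: b; case: b'; rewrite /sg /=; ring. Qed.

Lemma sqr_sg_sub b b' : (sg b - sg b') ^+ 2 <= 4.
Proof. by case: b; case: b'; rewrite /sg; lra. Qed.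

End Sign.

(** * Averaging, and an upper bound on powers *)

Lemma exists_ge_mean {R : realType} {I : finType} (f : I -> R) (m : R) :
  (0 < #|I|)%N -> #|I|%:R * m <= \sum_i f i -> exists i, m <= f i.
Proof.
move=> /card_gt0P[i0 _] le_sum; apply: contrapT => /forallNP nge.
move: le_sum; apply/negP; rewrite -ltNge mulr_natl -sumr_const.
by apply: ltr_sum => [|i _]; [apply/hasP; exists i0; rewrite ?mem_index_enum|
  rewrite ltNge; apply/negP/nge].
Qed.

(** Induction on [(1 + c) (1 - (k+1) c) <= 1 - k c]. When [k c <= 1/2] it caps [(1 + c)^k] at 2. *)
Lemma bernoulli_upper {R : realType} (c : R) k :
  0 <= c -> (1 + c) ^+ k * (1 - k%:R * c) <= 1.
Proof.
move=> c0; elim: k => [|k IH]; first by rewrite mul1r mul0r subr0.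
apply: le_trans IH; rewrite exprS mulrAC mulrC ler_wpM2l ?exprn_ge0 ?addr_ge0 //.
rewrite -natr1; have : 0 <= k%:R * c * c by rewrite !mulr_ge0.
have := sqr_ge0 c; lra.
Qed.

(** * Hypercube instances: the [d sqrt T] term *)

Section Hypercube.
Context {R : realType} {d : nat} (delta kappa : R).
Hypotheses (kappa0 : 0 < kappa) (delta0 : 0 <= delta).
Hypothesis small : delta * d%:R <= param_radius kappa.
Let A : finType := {ffun 'I_d -> bool}.

Definition cube_phi (x : unit) (a : A) : 'rV[R]_d :=
  \row_i (sg (a i) / Num.sqrt d%:R).

Definition cube_theta (v : A) : 'rV[R]_d :=
  \row_i (sg (v i) * (delta * Num.sqrt d%:R)).

Definition flip (i : 'I_d) (v : A) : A :=
  [ffun j => if j == i then ~~ v j else v j].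

Lemma flipK i : involutive (flip i).
Proof.
by move=> v; apply/ffunP => j; rewrite !ffunE; case: eqP => //; rewrite negbK.
Qed.

Let sqrt_dK (i : 'I_d) : Num.sqrt d%:R * Num.sqrt d%:R = d%:R :> R.
Proof. by rewrite -expr2 sqr_sqrtr. Qed.

Let sqrt_d_neq0 (i : 'I_d) : Num.sqrt d%:R != 0 :> R.
Proof. by rewrite sqrtr_eq0 -ltNge ltr0n (leq_ltn_trans _ (ltn_ord i)). Qed.

Lemma cube_phi1 x a : normv (cube_phi x a) <= 1.
Proof.
rewrite normv_le // expr1n /dotv.
rewrite (eq_bigr (fun _ => d%:R^-1)) => [|i _]; last first.
  by rewrite !mxE mulrACA sgM mul1r -invfM (sqrt_dK i).
rewrite sumr_const card_ord -[_ *+ d]mulr_natl.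
by have [->|d0] := eqVneq (d%:R : R) 0; rewrite ?mul0r ?divff.
Qed.

Lemma cube_theta_norm v : normv (cube_theta v) <= param_radius kappa.
Proof.
apply: le_trans small; rewrite normv_le ?mulr_ge0 // /dotv.
rewrite (eq_bigr (fun _ => delta ^+ 2 * d%:R)) => [|i _]; last first.
  by rewrite !mxE mulrACA sgM mul1r mulrACA (sqrt_dK i).
rewrite sumr_const card_ord -[_ *+ d]mulr_natl le_eqVlt; apply/orP; left; apply/eqP; ring.
Qed.

Lemma cube_dot x a v :
  dotv (cube_phi x a) (cube_theta v) = delta * \sum_i sg (v i) * sg (a i).
Proof.
rewrite mulr_sumr; apply: eq_bigr => i _; rewrite !mxE.
by field; exact: sqrt_d_neq0.
Qed.

Definition wrong (v : A) (i : 'I_d) (x : unit) (a b : A) : R :=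
  (a i != v i)%:R + (b i != v i)%:R.

(** Compare with the action [v] itself: each wrong sign costs [2 delta]. *)
Lemma cube_gap v x a b : 2 * delta * \sum_i wrong v i x a b <=
  gap cube_phi (cube_theta v) x a + gap cube_phi (cube_theta v) x b.
Proof.
have half (c : A) : 2 * delta * \sum_i (c i != v i)%:R <= gap cube_phi (cube_theta v) x c.
  apply: le_trans (reward_le_gap _ _ x c v).
  rewrite /reward ![dotv (cube_theta v) _]dotvC !cube_dot -mulrBr -sumrB.
  rewrite [2 * _]mulrC -mulrA ler_wpM2l // mulr_sumr ler_sum // => i _.
  by rewrite sgM one_sub_sgM.
by rewrite /wrong big_split mulrDr lerD.
Qed.

Definition cube_label (v : A) (x : unit) (a b : A) : R :=
  link kappa (dotv (cube_phi x a - cube_phi x b) (cube_theta v)).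

Lemma cube_labelE v x a b : cube_label v x a b =
  1 / 2 + kappa * delta * \sum_i sg (v i) * (sg (a i) - sg (b i)).
Proof.
rewrite /cube_label (link_label _ _ kappa0 cube_phi1) ?cube_theta_norm //.
rewrite dotvBl !cube_dot -mulrBr -sumrB mulrA.
by congr (_ + _ * _); apply: eq_bigr => i _; rewrite mulrBr.
Qed.

Lemma cube_label_range v x a b : 3 / 8 <= cube_label v x a b <= 5 / 8.
Proof.
have := label_range _ _ kappa0 cube_phi1 x a b _ (cube_theta_norm v).
rewrite /cube_label (link_label _ _ kappa0 cube_phi1) ?cube_theta_norm //.
by rewrite ler_norml; lra.
Qed.

(** The chi-square hypothesis of [two_instances]. Only the [i]-th term changes, by at most
    [4 kappa delta] in absolute value; [80] is [16] divided by the lower bound [1/5] on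
    [p (1-p)]. *)
Lemma cube_label_flip i v x a b :
  (cube_label (flip i v) x a b - cube_label v x a b) ^+ 2 <=
  80 * (kappa * delta) ^+ 2 * (cube_label v x a b * (1 - cube_label v x a b)).
Proof.
have := cube_label_range v x a b; set p := cube_label v x a b => pP.
have pp : 1 / 5 <= p * (1 - p) by nra.
apply: (@le_trans _ _ (80 * (kappa * delta) ^+ 2 * (1 / 5))); last first.
  by rewrite ler_wpM2l // mulr_ge0 // sqr_ge0.
have -> : cube_label (flip i v) x a b - p =
          - (2 * (kappa * delta)) * (sg (v i) * (sg (a i) - sg (b i))).
  rewrite /p !cube_labelE (bigD1 i) //= [in X in _ - X](bigD1 i) //= ffunE eqxx sgN.
  rewrite (eq_bigr (fun j => sg (v j) * (sg (a j) - sg (b j)))) => [|j /negPf ji].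
    ring.
  by rewrite ffunE ji.
rewrite exprMn sqrrN exprMn [X in _ * X]exprMn [X in _ * (X * _)]expr2 sgM mul1r.
have := ler_wpM2l (sqr_ge0 (kappa * delta)) (@sqr_sg_sub R (a i) (b i)); lra.
Qed.

(** Assouad's argument: each parameter is paired with its neighbour across every coordinate. *)
Lemma cube_regret (ctx : nat -> unit) (pol : seq (obs unit A) -> unit -> A -> A -> R)
    (T : nat) :
  (forall ho x, weights (pol ho x)) ->
  T%:R * (kappa * delta) ^+ 2 <= 1 / 160 ->
  exists v, delta * (d%:R * T%:R) <=
    exp_regret cube_phi (cube_theta v) (link kappa) ctx
      (fun _ _ _ _ _ => false) pol T [::].
Proof.
move=> polP Tsmall.
pose V v i := payoff ctx pol (wrong v i) (cube_label v) T [::].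
have VP v i : T%:R <= V v i + V (flip i v) i.
  have chi0 : 0 <= 80 * (kappa * delta) ^+ 2 by rewrite mulr_ge0 ?sqr_ge0.
  have w0 u x a b : 0 <= wrong u i x a b by rewrite addr_ge0.
  have lab v' x a b : 0 < cube_label v' x a b < 1.
    by have := cube_label_range v' x a b; lra.
  have wD x a b : wrong v i x a b + wrong (flip i v) i x a b = 2.
    rewrite /wrong ffunE eqxx.
    by case: (v i); case: (a i); case: (b i); rewrite /=; ring.
  have := two_instances ctx pol polP _ _ _ _ 2 _ T [::] 1 chi0 (lab v)
    (cube_label_flip i v) (w0 v) (w0 (flip i v)) wD.
  (* From ratio 1 the bound is [2 T (1 - e/4)], at least [T] once [e <= 2]. *)
  rewrite mul1r; apply: le_trans.
  have := bernoulli_upper (80 * (kappa * delta) ^+ 2) T chi0.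
  set e := (1 + _) ^+ T => eP.
  have e1 : 1 <= e by rewrite exprn_ege1 // lerDl.
  have e2 : e <= 2 by nra.
  have := ler0n R T; nra.
(* [flip i] permutes the parameters, so the pair bound gives each coordinate a mean error count of
   at least [T/2]. *)
have sumV : #|A|%:R * (d%:R * T%:R / 2) <= \sum_v \sum_i V v i.
  rewrite exchange_big /=.
  have H i : #|A|%:R * (T%:R / 2) <= \sum_v V v i.
    have : \sum_(v : A) T%:R <= \sum_v (V v i + V (flip i v) i) by exact: ler_sum.
    have -> : \sum_v (V v i + V (flip i v) i) = 2 * \sum_v V v i.
      rewrite mulr_natl mulr2n [X in _ = _ + X](reindex_inj (inv_inj (flipK i))).
      exact: big_split.
    rewrite sumr_const -[_ *+ #|_|]mulr_natl; lra.
  apply: le_trans (ler_sum _ (fun i _ => H i)).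
  by rewrite sumr_const card_ord -[_ *+ d]mulr_natl; lra.
have A0 : (0 < #|A|)%N by apply/card_gt0P; exists [ffun => true].
have [v vP] := exists_ge_mean _ _ A0 sumV.
exists v; rewrite exp_regret_uncorrupted.
apply: (@le_trans _ _ (2 * delta * \sum_i V v i)); last first.
  rewrite -(payoff_sum ctx pol polP _ (wrong v)) -payoffZ.
  apply: ler_payoff => // [x a b|x a b].
    exact: link01.
  exact: cube_gap.
by have := ler_wpM2l delta0 vP; lra.
Qed.

End Hypercube.

(** * Signed basis instances: the [d C] term *)

Section SignedBasis.
Context {R : realType} {d : nat} (kappa : R).
Hypothesis kappa0 : 0 < kappa.
Let A : finType := ('I_d * bool)%type.
Let B : R := param_radius kappa.
Let B0 : 0 < B. Proof. exact: param_radius_gt0. Qed.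

Definition basis_phi (x : unit) (a : A) : 'rV[R]_d :=
  \row_j (sg a.2 * (j == a.1)%:R).

Definition basis_theta (w : A) : 'rV[R]_d := B *: basis_phi tt w.

Lemma basis_dot a w : dotv (basis_phi tt a) (basis_phi tt w) =
  sg a.2 * sg w.2 * (a.1 == w.1)%:R.
Proof.
rewrite /dotv (bigD1 a.1) //= big1 ?addr0 => [|j /negPf ja]; last first.
  by rewrite !mxE ja mulr0 mul0r.
by rewrite !mxE eqxx mulr1 mulrA.
Qed.

Lemma basis_phi1 x a : normv (basis_phi x a) <= 1.
Proof. by case: x; rewrite normv_le // expr1n basis_dot sgM eqxx mulr1. Qed.

Lemma basis_theta_dot a w : dotv (basis_phi tt a) (basis_theta w) =
  B * (sg a.2 * sg w.2 * (a.1 == w.1)%:R).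
Proof.
rewrite -basis_dot mulr_sumr; apply: eq_bigr => i _.
by rewrite [basis_theta _ _ _]mxE mulrCA.
Qed.

Lemma basis_theta_norm w : normv (basis_theta w) <= B.
Proof.
rewrite (normv_le _ _ (ltW B0)) /basis_theta.
have -> : dotv (B *: basis_phi tt w) (B *: basis_phi tt w) =
          B * dotv (basis_phi tt w) (basis_theta w).
  by rewrite mulr_sumr; apply: eq_bigr => i _; rewrite /basis_theta !mxE; ring.
by rewrite basis_theta_dot sgM eqxx !mulr1 expr2.
Qed.

Definition basis_reward (w a : A) : R := B * (sg a.2 * sg w.2 * (a.1 == w.1)%:R).

Definition basis_loss (w : A) (x : unit) (a b : A) : R :=
  (B - basis_reward w a) + (B - basis_reward w b).

Definition informative (w : A) (x : unit) (a b : A) : bool :=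
  (a.1 == w.1) || (b.1 == w.1).

Lemma basis_loss_gap w x a b : basis_loss w x a b <=
  gap basis_phi (basis_theta w) x a + gap basis_phi (basis_theta w) x b.
Proof.
have half (c : A) : B - basis_reward w c <= gap basis_phi (basis_theta w) x c.
  apply: le_trans (reward_le_gap _ _ x c w).
  case: x; rewrite /reward ![dotv (basis_theta w) _]dotvC !basis_theta_dot.
  by rewrite sgM eqxx !mulr1.
exact: lerD.
Qed.

Lemma basis_reward_ge w a : - B <= basis_reward w a.
Proof.
rewrite /basis_reward.
by case: a.2; case: w.2; case: eqP => _; rewrite /sg /=; move: B0; lra.
Qed.

(** The two signs of the hidden coordinate cancel. *)
Lemma sum_basis_reward a : \sum_w basis_reward w a = 0.
Proof.
rewrite /basis_reward -(pair_bigA _ (fun i s => B * (sg a.2 * sg s * (a.1 == i)%:R))) /=.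
by apply: big1 => i _; rewrite big_bool /sg /=; ring.
Qed.

Lemma sum_basis_loss x a b : \sum_w basis_loss w x a b = 4 * d%:R * B.
Proof.
rewrite big_split !sumrB /= !sum_basis_reward sumr_const card_prod card_ord card_bool.
by rewrite -[_ *+ (d * 2)]mulr_natl natrM; ring.
Qed.

(** A duel touches at most two coordinates, each shared by two parameters. *)
Lemma sum_informative x a b : \sum_w (informative w x a b)%:R <= 4 :> R.
Proof.
have one (c : A) : \sum_(w : A) (c.1 == w.1)%:R = 2 :> R.
  rewrite -(pair_bigA _ (fun i (s : bool) => (c.1 == i)%:R)) /=.
  rewrite (bigD1 c.1) //= [X in _ + X]big1 ?addr0 => [|i ic].
    by rewrite eqxx sumr_const card_bool.
  by apply: big1 => s _; rewrite eq_sym (negPf ic).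
apply: (@le_trans _ _ (\sum_(w : A) ((a.1 == w.1)%:R + (b.1 == w.1)%:R))).
  apply: ler_sum => w _; rewrite /informative.
  by case: (a.1 == _); case: (b.1 == _); rewrite /=; lra.
by rewrite big_split /= !one; lra.
Qed.

Lemma basis_regret (ctx : nat -> unit) (pol : seq (obs unit A) -> unit -> A -> A -> R)
    (C T m : nat) :
  (0 < d)%N -> (forall ho x, weights (pol ho x)) ->
  (8 * m <= C)%N -> (d * C <= T)%N ->
  exists w (adv : adversary unit A), budget_ok adv C /\
    (d * m)%:R * B <=
    exp_regret basis_phi (basis_theta w) (link kappa) ctx adv pol T [::].
Proof.
(* Averaged over the [2 d] parameters, a round loses [2 B] and pays at most [lam (2/d) = B] for
   corruption, which leaves [B]. With this [lam], [8 m <= C] gives [4 B d m <= lam C]. *)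
move=> d0 polP mC CT; pose lam : R := d%:R * B / 2.
pose V w := payoff ctx pol
  (fun x a b => basis_loss w x a b - lam * (informative w x a b)%:R)
  (fun _ _ _ => 1 / 2) (d * m) [::].
have lam0 : 0 <= lam by rewrite /lam divr_ge0 // mulr_ge0 // ltW.
have A0 : (0 < #|A|)%N by rewrite card_prod card_ord card_bool muln_gt0 d0.
have [w wP] : exists w, (d * m)%:R * B <= V w.
  apply: exists_ge_mean => //.
  rewrite -payoff_sum // card_prod card_ord card_bool.
  apply: (@le_trans _ _ (payoff ctx pol (fun _ _ _ => 2 * d%:R * B)
     (fun _ _ _ => 1 / 2) (d * m) [::])).
    by rewrite payoff_cst // !natrM le_eqVlt; apply/orP; left; apply/eqP; ring.
  apply: ler_payoff => // [_ _ _|x a b]; first by lra.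
  rewrite sumrB sum_basis_loss -mulr_sumr.
  have := ler_wpM2l lam0 (sum_informative x a b); rewrite {2}/lam; lra.
exists w, (greedy basis_phi (basis_theta w) (link kappa) ctx pol C T).
split; first exact: greedy_budget.
rewrite exp_regret_greedy ?addn0 //; apply: le_trans wP _.
have := worst_ge_fair basis_phi (basis_theta w) (link kappa) ctx pol polP
  (link01 kappa) C (basis_loss w) (informative w) (4 * B) lam (d * m) lam0.
move=> /(_ _ _ _ _ _ T (d * m) [::]).
rewrite mulr0 subr0; apply => //.
- by rewrite mulr_ge0 // ltW.
- have : (8 * m)%:R <= C%:R :> R by rewrite ler_nat.
  have dB : 0 <= d%:R * B by rewrite mulr_ge0 // ltW.
  move=> /(ler_wpM2l dB); rewrite /lam !natrM; lra.
- exact: basis_loss_gap.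
- move=> x a b; rewrite /basis_loss.
  by have := basis_reward_ge w a; have := basis_reward_ge w b; lra.
- case=> a b; rewrite negb_or => /andP[/negPf aw /negPf bw].
  rewrite link_affine dotvBl !basis_theta_dot aw bw !mulr0 subrr mulr0 ?normr0; lra.
- by apply: leq_trans CT; rewrite leq_mul2l; lia.
Qed.

End SignedBasis.

(** * Choice between the two families *)

Theorem theorem5p4 (R : realType) :
  exists c : R, 0 < c /\
  forall (d : nat) (alg : algorithm R d), valid_algorithm alg ->
  forall (C T : nat) (kappa : R), 0 < kappa ->
    4 * (d%:R : R) ^+ 2 / 25 <= (T%:R : R) -> ((d * C)%:R : R) <= (T%:R : R) ->
    exists (X : Type) (A : finType) (phi : X -> A -> 'rV[R]_d)
           (B : R) (theta : 'rV[R]_d) (sigma : R -> R)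
           (ctx : nat -> X) (adv : adversary X A),
      [/\ (0 < #|A|)%N /\ (forall x a, normv (phi x a) <= 1),
          0 <= B /\ normv theta <= B,
          budget_ok adv C,
          [/\ (forall z w : R, z < w -> sigma z < sigma w),
              (forall z, 0 <= sigma z <= 1),
              (forall z, sigma z + sigma (- z) = 1) &
              (forall x a b (th : 'rV[R]_d), normv th <= B ->
                 derivable sigma (dotv (phi x a - phi x b) th) 1 /\
                 kappa <= derive1 sigma (dotv (phi x a - phi x b) th))] &
          c * ((d%:R) * Num.sqrt (T%:R) + (d * C)%:R) / kappa <=
            exp_regret phi theta sigma ctx adv
              (alg X A phi B sigma C T) T [::]].
Proof.
(* The two cases below need [9 c <= 1/40] and [(9/8) c <= 1/256]. *)
exists (1 / 400); split=> [|d alg algP C T kappa kappa0 dT dCT]; first by lra.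
have BP := param_radius_gt0 kappa kappa0; have kB := param_radiusK kappa kappa0.
have kN0 : kappa != 0 by rewrite gt_eqF.
set s := Num.sqrt (T%:R : R).
have s0 : 0 <= s by exact: sqrtr_ge0.
have ssT : s ^+ 2 = T%:R by rewrite sqr_sqrtr.
have ds : 2 * d%:R <= 5 * s.
  have : (2 * d%:R / 5) ^+ 2 <= s ^+ 2 :> R by rewrite ssT; lra.
  by rewrite ler_sqr ?nnegrE ?divr_ge0 ?mulr_ge0 //; lra.
(* The non-strict side also takes [d = 0]. *)
have [few|many] := leP (d * C)%:R (8 * (d%:R * s)).
(* The constant 40 gives [kappa delta d <= (5/2) / 40 = 1/16], so the parameters fit in the ball. *)
- have delta0 : 0 <= (40 * kappa * s)^-1 by rewrite invr_ge0 !mulr_ge0 // ltW.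
  set delta := (40 * kappa * s)^-1 in delta0.
  have kd : kappa * delta * s <= 1 / 40.
    (* If [T = 0], then [delta = 0], the inverse of 0 being 0. *)
    rewrite /delta; have [->|sN0] := eqVneq s 0; first by rewrite mulr0; lra.
    by have -> : kappa * (40 * kappa * s)^-1 * s = 1 / 40; [field; rewrite kN0 sN0 | ].
  have small : delta * d%:R <= param_radius kappa.
    rewrite -(ler_pM2l kappa0) kB.
    have := ler_wpM2l (mulr_ge0 (ltW kappa0) delta0) ds; lra.
  have Tsmall : T%:R * (kappa * delta) ^+ 2 <= 1 / 160.
    rewrite -ssT -exprMn mulrC.
    have : (kappa * delta * s) ^+ 2 <= (1 / 40) ^+ 2.
      by rewrite ler_sqr ?nnegrE ?mulr_ge0 // ?ltW //; lra.
    lra.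
  pose A : finType := {ffun 'I_d -> bool}.
  have A0 : (0 < #|A|)%N by apply/card_gt0P; exists [ffun => true].
  have polP := fun ho x =>
    algP unit A cube_phi (param_radius kappa) (link kappa) C T ho x A0.
  have [v vP] := cube_regret delta kappa kappa0 delta0 small (fun=> tt) _ T polP Tsmall.
  exists unit, A, cube_phi, (param_radius kappa), (cube_theta delta v), (link kappa),
    (fun=> tt), (fun _ _ _ _ _ => false); split=> //.
  + by split=> // x a; exact: cube_phi1.
  + by split; [exact: ltW | exact: cube_theta_norm].
  + split; [by move=> z w; exact: link_lt | exact: link01 | exact: linkN |].
    by move=> x a b th; apply: link_slope => // y c; exact: cube_phi1.
  + apply: le_trans vP.
    rewrite ler_pdivrMr //.
    have -> : delta * (d%:R * T%:R) * kappa = d%:R * s / 40.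
      rewrite -ssT /delta; have [->|sN0] := eqVneq s 0; first by ring.
      by field; rewrite kN0 sN0.
    have := mulr_ge0 (ler0n R d) s0; lra.
- have d0 : (0 < d)%N.
    by case: d {alg algP dT dCT ds} many => // ; rewrite mul0n mul0r mulr0 ltxx.
  have d0R : 0 < d%:R :> R by rewrite ltr0n.
  have Cs : 8 * s < C%:R by move: many; rewrite natrM mulrCA ltr_pM2l.
  have T1 : 1 <= s.
    have d1 : 1 <= d%:R :> R by rewrite ler1n.
    by rewrite -[leLHS]sqrtr1 ler_wsqrtr // ler1n -(ltr0n R) -sqrtr_gt0 -/s; lra.
  (* Hence rounding [C/8] down loses at most a factor 2. *)
  have C8 : (8 <= C)%N by rewrite -(ler_nat R); lra.
  pose A : finType := ('I_d * bool)%type.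
  have A0 : (0 < #|A|)%N by rewrite card_prod card_ord card_bool muln_gt0 d0.
  have polP := fun ho x =>
    algP unit A basis_phi (param_radius kappa) (link kappa) C T ho x A0.
  have [||w [adv [advC wP]]] :=
    basis_regret kappa kappa0 (fun=> tt) _ C T (C %/ 8) d0 polP.
  + by lia.
  + by rewrite -(ler_nat R).
  exists unit, A, basis_phi, (param_radius kappa), (basis_theta kappa w), (link kappa),
    (fun=> tt), adv; split=> //.
  + by split=> // x a; exact: basis_phi1.
  + by split; [exact: ltW | exact: basis_theta_norm].
  + split; [by move=> z y; exact: link_lt | exact: link01 | exact: linkN |].
    by move=> x a b th; apply: link_slope => // y c; exact: basis_phi1.
  + apply: le_trans wP; rewrite ler_pdivrMr // -[leRHS]mulrA [_ * kappa]mulrC kB.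
    have : C%:R <= (16 * (C %/ 8))%:R :> R by rewrite ler_nat; lia.
    move=> /(ler_wpM2l (ltW d0R)); move: many; rewrite !natrM.
    have := mulr_ge0 (ltW d0R) (ler0n R (C %/ 8)); lra.
Qed.
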